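(* Let $X_1,\dots,X_n$ be independent and identically distributed real random variables with distribution function $F$, let $X_{1:n}=\min(X_1,\dots,X_n)$, and let $t$ be such that $F(t)<1$. Let $T_i^{(n,t)}=(X_i\mid X_{1:n}>t)$, $i=1,\dots,n$. Then $T_1^{(n,t)},\dots,T_n^{(n,t)}$ are independent and identically distributed, and $T_1^{(n,t)}\overset{d}{=}(X_1\mid X_1>t)$.
   Context: $F(x)=P\{X_1\le x\}$. The conditional random variables $(X_1\mid A),\dots,(X_n\mid A)$, for an event $A$ with $P(A)>0$, are random variables whose joint law is the conditional law of $(X_1,\dots,X_n)$ given $A$, i.e. with joint distribution function $P\{X_1\le x_1,\dots,X_n\le x_n\mid A\}$. $\overset{d}{=}$ denotes equality in distribution. *)

(* Defs.v *)
From HB Require Import structures.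
From mathcomp Require Import all_boot all_order all_algebra.
From mathcomp Require Import all_classical all_reals all_analysis.

Set Implicit Arguments.
Unset Strict Implicit.
Unset Printing Implicit Defensive.

Import Order.TTheory GRing.Theory Num.Theory.

Local Open Scope classical_set_scope.
Local Open Scope ring_scope.
Local Open Scope ereal_scope.

(* Equality in law is only required on measurable sets: a measure has
   unspecified values elsewhere.  The two variables may live on different
   probability spaces. *)
Definition eq_in_law {R : realType} {d d' : measure_display}
    {Omega : measurableType d} {Omega' : measurableType d'}
    (P : probability Omega R) (X : {RV P >-> R})
    (Q : probability Omega' R) (Y : {RV Q >-> R}) : Prop :=
  forall B : set R, measurable B -> distribution P X B = distribution Q Y B.

Definition identically_distributed {R : realType} {d : measure_display}
    {Omega : measurableType d} {I : Type}
    (P : probability Omega R) (X : I -> {RV P >-> R}) : Prop :=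
  forall i j : I, eq_in_law (X i) (X j).

Definition mutually_independent {R : realType} {d : measure_display}
    {Omega : measurableType d} {I : finType}
    (P : probability Omega R) (X : I -> {RV P >-> R}) : Prop :=
  forall (J : {set I}) (B : I -> set R), (forall i, measurable (B i)) ->
    P [set w | forall i, i \in J -> B i (X i w)] =
    \prod_(i in J) P (X i @^-1` B i).

Definition sample_min {R : realType} {d : measure_display}
    {Omega : measurableType d} {n : nat}
    (P : probability Omega R) (X : 'I_n.+1 -> {RV P >-> R}) (w : Omega) : R :=
  \big[Num.min/X ord0 w]_(i < n.+1) X i w.

(* Only meaningful when 0 < P A. *)
Definition cond_prob {R : realType} {d : measure_display}
    {Omega : measurableType d} (P : probability Omega R) (B A : set Omega)
    : \bar R :=
  P (B `&` A) / P A.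

(* The family Y, on a possibly different probability space, is a version of
   the family (X_i | A): its joint distribution function is
   x |-> P{X_i <= x_i for all i | A}. *)
Definition is_cond_family {R : realType} {d d' : measure_display}
    {Omega : measurableType d} {Omega' : measurableType d'} {I : finType}
    (P : probability Omega R) (X : I -> {RV P >-> R}) (A : set Omega)
    (Q : probability Omega' R) (Y : I -> {RV Q >-> R}) : Prop :=
  forall x : I -> R,
    Q [set w | forall i, (Y i w <= x i)%R] =
    cond_prob P [set w | forall i, (X i w <= x i)%R] A.

Definition is_cond_variable {R : realType} {d d' : measure_display}
    {Omega : measurableType d} {Omega' : measurableType d'}
    (P : probability Omega R) (X : {RV P >-> R}) (A : set Omega)
    (Q : probability Omega' R) (Y : {RV Q >-> R}) : Prop :=
  is_cond_family (fun _ : 'I_1 => X) A (fun _ : 'I_1 => Y).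

(* Versions of (X_i | A) always exist: take the same functions under the
   measure P( . | A). *)
Lemma cond_family_exists {R : realType} {d : measure_display}
    {Omega : measurableType d} {I : finType}
    (P : probability Omega R) (X : I -> {RV P >-> R}) (A : set Omega) :
  measurable A -> 0 < P A ->
  exists (Q : probability Omega R) (Y : I -> {RV Q >-> R}), is_cond_family X A Y.
Proof.
move=> mA PA; exists (mnormalize (mrestr P mA) P), X => x.
have PAfin : P A \is a fin_num by rewrite fin_num_measure.
have PA0 : fine (P A) != 0%R by rewrite fine_eq0// gt_eqF.
rewrite /cond_prob -[in RHS](fineK PAfin) inver (negPf PA0).
have mE B : (mrestr P mA : {measure set Omega -> \bar R}) B = P (B `&` A) by [].
rewrite /=; unfold mnormalize; rewrite !mE setTI (gt_eqF PA)/=.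
by rewrite (_ : (P A == +oo) = false)//; case: (P A) PAfin.
Qed.

(* Main.v *)
Require Import Defs.
From HB Require Import structures.
From mathcomp Require Import all_boot all_order all_algebra.
From mathcomp Require Import all_classical all_reals all_analysis.

Set Implicit Arguments.
Unset Strict Implicit.
Unset Printing Implicit Defensive.

Import Order.TTheory GRing.Theory Num.Theory.

Local Open Scope classical_set_scope.
Local Open Scope ring_scope.
Local Open Scope ereal_scope.

(** Write C for the half-line above t.  The sample minimum exceeds t exactly
    when every X_i lies in C, so the conditioning event is itself a box: an
    intersection of independent events, one for each coordinate.
    Intersecting it with another box {X_i in B_i for all i} gives the box with
    sides B_i `&` C, and by independence the quotient of the two probabilities
    factors,
<<
      P(X_i in B_i for all i | X_i in C for all i)
        = \prod_i P(X_i in B_i | X_i in C).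
>>
    This works for conditioning on any box of positive probability.  As the
    X_i are identically distributed, every factor is the same probability
    measure, the law of X_0 given X_0 in C, evaluated at B_i: this gives both
    the independence and the common law of the T_i.

    A version T of the conditional family is only known through its joint
    distribution function, that is on boxes with sides ]-oo, x_i].  The bulk of
    the work is [box_law_of_df], which passes from these boxes to boxes with
    arbitrary Borel sides by exchanging one side at a time, each exchange being
    the uniqueness of a finite measure on the line with prescribed values on
    half-lines.  The factorization is then [cond_box_law].  A version of
    (X_0 | X_0 > t) is covered by the same lemma, as a family with one member. *)

(** * Measures on the real line and half-lines *)

Lemma measurable_halflineE (R : realType) :
  (measurable : set (set R)) =
  <<s [set `]-oo, x]%classic | x in [set: R]] >>.
Proof.
rewrite eqEsubset; split => A.
  have -> : (measurable : set (set R)) = _ :=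
    measurable_realfun.RGenOInfty.measurableE R.
  apply: smallest_sub => {A}.
    exact: smallest_sigma_algebra.
  move=> A [x ->]; rewrite -setCitvl -setTD; apply: sigma_algebraCD.
  by apply: sub_sigma_algebra; exists x.
apply: smallest_sub; first exact: sigma_algebra_measurable.
by move=> _ [x _ <-]; exact: measurable_itv.
Qed.

(** Half-lines are closed under intersection and generate the Borel sets; as
    those ending at the natural numbers exhaust the line, they also fix the
    total mass. *)
Lemma eq_measure_halfline (R : realType) (m1 m2 : {measure set R -> \bar R}) :
  m1 [set: R] < +oo ->
  (forall x : R, m1 `]-oo, x]%classic = m2 `]-oo, x]%classic) ->
  forall B : set R, measurable B -> m1 B = m2 B.
Proof.
move=> m1oo m12; apply: (measure_unique
  [set `]-oo, x]%classic | x in [set: R]] (fun k => `]-oo, k%:R]%classic)).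
- exact: measurable_halflineE.
- move=> _ _ [x _ <-] [y _ <-]; exists (Num.min x y) => //.
  by apply/seteqP; split => z /=; rewrite !in_itv/= le_min => /andP.
- by move=> k; exists k%:R.
- rewrite -subTset => x _; exists (Num.truncn `|x|).+1 => //=.
  rewrite in_itv/=; apply/(le_trans (ler_norm x))/ltW.
  exact: truncnS_gt.
- by move=> _ [x _ <-].
- move=> k; apply: le_lt_trans m1oo; by apply: le_measure; rewrite ?inE.
Qed.

(** * Laws of boxes *)

Lemma measurable_box (R : realType) (d : measure_display)
    (Omega : measurableType d) (P : probability Omega R) (I : finType)
    (X : I -> {RV P >-> R}) (B : I -> set R) :
  (forall i, measurable (B i)) -> measurable [set w | forall i, B i (X i w)].
Proof.
move=> mB; have -> : [set w | forall i, B i (X i w)] =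
    \bigcap_(i in [set: I]) X i @^-1` B i.
  by apply/seteqP; split => w /= Hw i => [_|]; apply: Hw.
apply: fin_bigcap_measurable => [|i _]; first exact: finite_finset.
exact: measurable_funPTI.
Qed.

(** A joint distribution function that factors forces the joint law to factor.
    With all sides but the j-th fixed, both members are finite measures in the
    j-th side; if they agree when this side is a half-line, they agree when it
    is a Borel set.  Hence the sides can be freed one after the other. *)
Lemma box_law_of_df (R : realType) (d : measure_display)
    (Omega : measurableType d) (P : probability Omega R) (I : finType)
    (X : I -> {RV P >-> R}) (nu : I -> probability R R) :
  (forall x : I -> R, P [set w | forall i, (X i w <= x i)%R] =
    \prod_i nu i `]-oo, x i]%classic) ->
  forall B : I -> set R, (forall i, measurable (B i)) ->
    P [set w | forall i, B i (X i w)] = \prod_i nu i (B i).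
Proof.
move=> Hdf.
(* The coordinates in s may have any Borel side, the others a half-line. *)
suff H (s : seq I) : forall B : I -> set R, (forall i, measurable (B i)) ->
    (forall i, i \notin s -> exists x, B i = `]-oo, x]%classic) ->
    P [set w | forall i, B i (X i w)] = \prod_i nu i (B i).
  by move=> B mB; apply: (H (enum I)) => // i; rewrite mem_enum.
elim: s => [|j s IHs] B mB Bs.
  have /choice[x Bx] : forall i, exists x, B i = `]-oo, x]%classic.
    by move=> i; exact: Bs.
  under eq_bigr do rewrite Bx.
  rewrite -Hdf; congr (P _); apply/seteqP.
  by split=> w /= Hw i; move: (Hw i); rewrite Bx /= in_itv.
have mBj C i : measurable C -> measurable (@dfwith I _ B j C i).
  by move=> mC; case: dfwithP.
pose E := [set w | forall i, @dfwith I _ B j setT i (X i w)].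
have mE : measurable E by apply: measurable_box => i; exact: mBj.
pose c := \prod_(i | i != j) nu i (B i).
have cfin : c \is a fin_num.
  by apply: prode_fin_num => i _; exact: fin_num_measure.
have c0 : (0 <= fine c)%R by apply/fine_ge0/prode_ge0.
have mX : measurable_fun [set: Omega] (X j) by exact: measurable_funPT.
(* The structure of measure on a pushforward depends on the measurability of
   the map, which remains here as an argument. *)
pose push : {measure set R -> \bar R} :=
  pushforward (mrestr P mE) (X j).
pose m1 := push mX.
pose m2 : {measure set R -> \bar R} := mscale (NngNum c0) (nu j).
have m1E C : m1 C = P [set w | forall i, @dfwith I _ B j C i (X i w)].
  congr (P _); apply/seteqP; split => w /=.
    move=> [wC wE] i; case: dfwithP => // k jk.
    by have := wE k; rewrite dfwithout.
  move=> Hw; split; first by have := Hw j; rewrite dfwithin.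
  move=> i; have := Hw i; case: dfwithP => [_|k jk]; first by rewrite dfwithin.
  by rewrite dfwithout.
have m2E C : m2 C = \prod_i nu i (@dfwith I _ B j C i).
  rewrite (bigD1 j)//= dfwithin /m2/= /mscale/= fineK// muleC; congr (_ * _).
  by apply: eq_bigr => i ij; rewrite dfwithout// eq_sym.
have BE : @dfwith I _ B j (B j) = B.
  by apply/funext => i; case: dfwithP.
rewrite -{1}BE -m1E -[in RHS]BE -m2E.
apply: eq_measure_halfline => //.
  rewrite m1E; apply: (@le_lt_trans _ _ 1); last exact: ltry.
  by apply: probability_le1; apply: measurable_box => i; exact: mBj.
move=> x; rewrite m1E m2E IHs// => i; first exact: mBj.
case: dfwithP => [_|k jk ks]; first by exists x.
by apply: Bs; rewrite inE negb_or eq_sym jk.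
Qed.

(** Subfamilies are covered by full boxes whose other sides are the whole
    line. *)
Lemma mutually_independentP (R : realType) (d : measure_display)
    (Omega : measurableType d) (P : probability Omega R) (I : finType)
    (X : I -> {RV P >-> R}) :
  mutually_independent X <->
  forall B : I -> set R, (forall i, measurable (B i)) ->
    P [set w | forall i, B i (X i w)] = \prod_i P (X i @^-1` B i).
Proof.
split=> [indepX B mB|boxX J B mB].
  have := indepX [set: I]%SET B mB; under eq_bigl do rewrite inE.
  move=> <-; congr (P _); apply/seteqP.
  by split => w /= Hw i => [_|]; apply: Hw; rewrite ?inE.
pose BJ i := if i \in J then B i else setT.
have mBJ i : measurable (BJ i) by rewrite /BJ; case: ifP.
have := boxX BJ mBJ; rewrite (bigID (mem J))/= [X in _ * X]big1 ?mule1.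
  move=> EJ; transitivity (P [set w | forall i, BJ i (X i w)]).
    congr (P _); apply/seteqP; rewrite /BJ.
    by split => w /= Hw i; have := Hw i; case: ifP => // _; exact.
  by rewrite EJ; apply: eq_bigr => i iJ; rewrite /BJ iJ.
by move=> i /negbTE iJ; rewrite /BJ iJ preimage_setT probability_setT.
Qed.

Lemma mutually_independent_ord1 (R : realType) (d : measure_display)
    (Omega : measurableType d) (P : probability Omega R) (X : {RV P >-> R}) :
  mutually_independent (fun _ : 'I_1 => X).
Proof.
apply/mutually_independentP => B mB; rewrite big_ord1; congr (P _).
by apply/seteqP; split => w /= Hw // i; rewrite ord1.
Qed.

(** * Conditioning an independent family on a box *)

(** Inversion is not multiplicative on the extended reals, so products of
    quotients of probabilities are computed in the real field. *)
Lemma cond_prob_fine (R : realType) (d : measure_display)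
    (Omega : measurableType d) (P : probability Omega R) (A B : set Omega) :
  measurable A -> measurable B -> 0 < P A ->
  cond_prob P B A = (fine (P (B `&` A)) / fine (P A))%:E.
Proof.
move=> mA mB PA.
have PA0 : fine (P A) != 0%R by rewrite fine_eq0 ?fin_num_measure// gt_eqF.
rewrite /cond_prob -[P A]fineK ?fin_num_measure// inver (negbTE PA0).
by rewrite -[P (_ `&` _)]fineK ?fin_num_measure//; exact: measurableI.
Qed.

(** Supplies the marginals that [box_law_of_df] expects as genuine measures. *)
Lemma cond_law_exists (R : realType) (d : measure_display)
    (Omega : measurableType d) (P : probability Omega R) (X : {RV P >-> R})
    (A : set Omega) :
  measurable A -> 0 < P A ->
  exists nu : probability R R, forall B : set R, measurable B ->
    nu B = cond_prob P (X @^-1` B) A.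
Proof.
move=> mA PA; pose PcA : probability Omega R := mnormalize (mrestr P mA) P.
exists (distribution PcA X) => B mB.
rewrite cond_prob_fine//; last exact: measurable_funPTI.
have mE C : (mrestr P mA : {measure set Omega -> \bar R}) C = P (C `&` A) by [].
have PAfin : P A \is a fin_num by exact: fin_num_measure.
rewrite /distribution /pushforward /PcA/= /mnormalize !mE setTI (gt_eqF PA)/=.
rewrite (_ : (P A == +oo) = false); last by case: (P A) PAfin.
rewrite EFinM fineK// fin_num_measure//; apply: measurableI => //.
exact: measurable_funPTI.
Qed.

Lemma fine_prode (R : realType) (I : finType) (f : I -> \bar R) :
  (forall i, f i \is a fin_num) -> fine (\prod_i f i) = (\prod_i fine (f i))%R.
Proof.
move=> ffin; rewrite (eq_bigr (fun i => (fine (f i))%:E)) ?prodEFin// => i _.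
by rewrite fineK.
Qed.

Lemma indep_box_gt0 (R : realType) (d : measure_display)
    (Omega : measurableType d) (P : probability Omega R) (I : finType)
    (X : I -> {RV P >-> R}) (C : I -> set R) :
  mutually_independent X ->
  (forall i, measurable (C i)) -> (forall i, 0 < P (X i @^-1` C i)) ->
  0 < P [set w | forall i, C i (X i w)].
Proof.
move=> /mutually_independentP boxX mC PC; rewrite boxX//.
have PCfin i : P (X i @^-1` C i) \is a fin_num.
  by rewrite fin_num_measure//; exact: measurable_funPTI.
rewrite (eq_bigr (fun i => (fine (P (X i @^-1` C i)))%:E)); last first.
  by move=> i _; rewrite fineK.
rewrite prodEFin lte_fin; apply: prodr_gt0 => i _.
by rewrite fine_gt0// PC/= ltey_eq PCfin.
Qed.

(** On boxes with half-line sides, the numerator of the conditional probability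
    is the probability of the box with sides H_i `&` C_i, and independence
    factors numerator and denominator alike; [box_law_of_df] extends this to
    all Borel sides. *)
Lemma cond_box_law (R : realType) (d d' : measure_display)
    (Omega : measurableType d) (Omega' : measurableType d')
    (P : probability Omega R) (Q : probability Omega' R) (I : finType)
    (X : I -> {RV P >-> R}) (T : I -> {RV Q >-> R}) (C : I -> set R) :
  mutually_independent X ->
  (forall i, measurable (C i)) -> (forall i, 0 < P (X i @^-1` C i)) ->
  is_cond_family X [set w | forall i, C i (X i w)] T ->
  forall B : I -> set R, (forall i, measurable (B i)) ->
    Q [set w | forall i, B i (T i w)] =
    \prod_i cond_prob P (X i @^-1` B i) (X i @^-1` C i).
Proof.
move=> indepX mC PC condT; have /mutually_independentP boxX := indepX.
have /choice[nu nuE] i :=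
  cond_law_exists (X i) (measurable_funPTI (X i) (mC i)) (PC i).
move=> B mB; under eq_bigr do rewrite -nuE//.
apply: box_law_of_df => // x.
under eq_bigr do rewrite nuE//.
have mXB D i : measurable D -> measurable (X i @^-1` D).
  by move=> mD; exact: measurable_funPTI.
have PXfin D i : measurable D -> P (X i @^-1` D) \is a fin_num.
  by move=> mD; exact/fin_num_measure/mXB.
pose H i : set R := `]-oo, x i]%classic.
have mH i : measurable (H i) by exact: measurable_itv.
have mHC i : measurable (H i `&` C i) by exact: measurableI.
have boxHC : [set w | forall i, (X i w <= x i)%R] `&`
    [set w | forall i, C i (X i w)] =
    [set w | forall i, (H i `&` C i) (X i w)].
  apply/seteqP; split => w /=.
    by move=> [wx wC] i; split; [rewrite /H/= in_itv/=; exact: wx|exact: wC].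
  move=> Hw; split=> i; last by have [] := Hw i.
  by have [+ _] := Hw i; rewrite /H/= in_itv.
have PCpos : 0 < P [set w | forall i, C i (X i w)] by exact: indep_box_gt0.
rewrite condT cond_prob_fine//; first last.
- have -> : [set w | forall i, (X i w <= x i)%R] = [set w | forall i, H i (X i w)].
    by apply/seteqP; split => w /= Hw i; have := Hw i; rewrite /H/= in_itv.
  exact: measurable_box.
- exact: measurable_box.
rewrite boxHC (boxX (fun i => H i `&` C i))// (boxX C)//.
rewrite !fine_prode; try by move=> i; exact: PXfin.
rewrite -prodf_div -prodEFin; apply: eq_bigr => i _.
by rewrite cond_prob_fine//; exact: mXB.
Qed.

(** * The conditional sample given its minimum *)

Theorem proposition3 (R : realType) (d : measure_display)
    (Omega : measurableType d) (P : probability Omega R) (n : nat)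
    (X : 'I_n.+1 -> {RV P >-> R}) (F : R -> R) (t : R)
    (X_indep : mutually_independent X) (X_ident : identically_distributed X)
    (F_df : forall x : R, cdf (X ord0) x = (F x)%:E) (Ft : (F t < 1)%R) :
  [/\ 0 < P [set w | (t < sample_min X w)%R],
      0 < P [set w | (t < X ord0 w)%R] &
      forall (d' : measure_display) (Omega' : measurableType d')
        (Q : probability Omega' R) (T : 'I_n.+1 -> {RV Q >-> R}),
        is_cond_family X [set w | (t < sample_min X w)%R] T ->
        [/\ mutually_independent T,
            identically_distributed T &
            forall (d'' : measure_display) (Omega'' : measurableType d'')
              (Q' : probability Omega'' R) (Y : {RV Q' >-> R}),
              is_cond_variable (X ord0) [set w | (t < X ord0 w)%R] Y ->
              eq_in_law (T ord0) Y]].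
Proof.
pose C : set R := `]t, +oo[%classic.
have mC : measurable C by exact: measurable_itv.
have CE x : C x = (t < x)%R :> Prop by rewrite /C/= in_itv/= andbT.
have PC : 0 < P (X ord0 @^-1` C).
  (* P(X_0 > t) = 0 would make F t equal to 1. *)
  have := cdf_ccdf_1 (X ord0) t; rewrite F_df => cc.
  rewrite ltNge; apply: contraTN Ft => PC0; rewrite -leNgt -lee_fin -cc.
  by rewrite geeDl.
have PCi i : 0 < P (X i @^-1` C).
  by have := X_ident i ord0 C mC; rewrite /distribution /pushforward => ->.
have minE : [set w | (t < sample_min X w)%R] = [set w | forall i, C (X i w)].
  apply/seteqP; split => w /=.
    by move=> /bigmin_gtP[_ tX] i; rewrite CE tX.
  by move=> tX; apply/bigmin_gtP; split=> [|i _]; rewrite -CE.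
have X0E : [set w | (t < X ord0 w)%R] = X ord0 @^-1` C.
  by apply/seteqP; split => w /=; rewrite CE.
rewrite minE X0E; split=> //.
  exact: (indep_box_gt0 X_indep (fun=> mC)).
move=> d' Omega' Q T condT.
pose law B := cond_prob P (X ord0 @^-1` B) (X ord0 @^-1` C).
have lawi i B : measurable B ->
    cond_prob P (X i @^-1` B) (X i @^-1` C) = law B.
  move=> mB; rewrite /law /cond_prob -!preimage_setI.
  by congr (_ / _); apply: X_ident => //; exact: measurableI.
have boxT B : (forall i, measurable (B i)) ->
    Q [set w | forall i, B i (T i w)] = \prod_i law (B i).
  move=> mB; rewrite (cond_box_law (C := fun=> C) X_indep _ _ condT)//.
  by apply: eq_bigr => i _; exact: lawi.
have lawT : law setT = 1.
  rewrite /law /cond_prob preimage_setT setTI divee ?gt_eqF//.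
  by rewrite fin_num_measure//; exact: measurable_funPTI.
have lawTi i B : measurable B -> Q (T i @^-1` B) = law B.
  move=> mB; pose B' := @dfwith _ _ (fun=> setT) i B : 'I_n.+1 -> set R.
  have -> : T i @^-1` B = [set w | forall j, B' j (T j w)].
    apply/seteqP; split => w /= Hw; last by have := Hw i; rewrite /B' dfwithin.
    by move=> j; rewrite /B'; case: dfwithP.
  rewrite boxT => [|j]; last by rewrite /B'; case: dfwithP.
  rewrite (bigD1 i)//= big1 => [|j ji]; first by rewrite /B' dfwithin mule1.
  by rewrite /B' dfwithout// eq_sym.
split.
- apply/mutually_independentP => B mB; rewrite boxT//.
  by apply: eq_bigr => i _; rewrite lawTi.
- by move=> i j B mB; rewrite /distribution /pushforward !lawTi.
move=> d'' Omega'' Q' Y condY B mB; rewrite /distribution /pushforward lawTi//.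
have box1E (U : Type) (Z : U -> R) (A : set R) :
    [set w | 'I_1 -> A (Z w)] = Z @^-1` A.
  by apply/seteqP; split => w /= Hw //; exact: Hw ord0.
have condY1 : is_cond_family (fun _ : 'I_1 => X ord0)
    [set w | 'I_1 -> C (X ord0 w)] (fun _ : 'I_1 => Y).
  by rewrite box1E.
have := cond_box_law (C := fun=> C) (mutually_independent_ord1 (X ord0))
  (fun=> mC) (fun=> PC) condY1 (B := fun=> B) (fun=> mB).
by rewrite box1E big_ord1.
Qed.
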